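(* Let $\mathbb{K}$ be a non-Archimedean valued field with valuation $|\cdot|$ and let $\mathcal{X}$ be a finite dimensional p-adic Hilbert space over $\mathbb{K}$ with norm $\|\cdot\|$ and p-adic inner product $\langle\cdot,\cdot\rangle$. Let $\{\tau_j\}_{j=1}^n$ and $\{\omega_k\}_{k=1}^n$ be two orthonormal bases for $\mathcal{X}$. If $M,N\subseteq\{1,\dots,n\}$ are such that $$\max_{j\in M,\,k\in N}|\langle\tau_j,\omega_k\rangle|<1,$$ then for all $x\in\mathcal{X}$, $$\|x\|\leq\left(\frac{1}{1-\max_{j\in M,\,k\in N}|\langle\tau_j,\omega_k\rangle|}\right)\max\left\{\max_{j\in M^c}|\langle x,\tau_j\rangle|,\ \max_{k\in N^c}|\langle x,\omega_k\rangle|\right\}.$$ In particular, if $x\in\mathcal{X}$ is supported on $M$ in the expansion using the basis $\{\tau_j\}_{j=1}^n$ and $x$ is supported on $N$ in the expansion using the basis $\{\omega_k\}_{k=1}^n$, then $x=0$.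
   Context: A p-adic Hilbert space over a non-Archimedean valued field $\mathbb{K}$ is a non-Archimedean Banach space $\mathcal{X}$ over $\mathbb{K}$ (complete, with norm satisfying $\|x+y\|\leq\max\{\|x\|,\|y\|\}$) together with a map $\langle\cdot,\cdot\rangle:\mathcal{X}\times\mathcal{X}\to\mathbb{K}$ (the p-adic inner product) such that: (i) if $x\in\mathcal{X}$ satisfies $\langle x,y\rangle=0$ for all $y\in\mathcal{X}$, then $x=0$; (ii) $\langle x,y\rangle=\langle y,x\rangle$ for all $x,y\in\mathcal{X}$; (iii) $\langle\alpha x+y,z\rangle=\alpha\langle x,z\rangle+\langle y,z\rangle$ for all $\alpha\in\mathbb{K}$ and $x,y,z\in\mathcal{X}$; (iv) $|\langle x,y\rangle|\leq\|x\|\|y\|$ for all $x,y\in\mathcal{X}$. A (vector space) basis $\{\tau_j\}_{j=1}^n$ for $\mathcal{X}$ is an orthonormal basis if (i) $\|\tau_j\|\leq 1$ for all $1\leq j\leq n$, and (ii) $\langle\tau_j,\tau_k\rangle=\delta_{j,k}$ for all $1\leq j,k\leq n$. For $M\subseteq\{1,\dots,n\}$, $M^c$ denotes the complement of $M$ in $\{1,\dots,n\}$. A vector $x$ is supported on $M$ in the expansion using $\{\tau_j\}_{j=1}^n$ if $\langle x,\tau_j\rangle=0$ for all $j\in M^c$ (and similarly for $N$ and $\{\omega_k\}_{k=1}^n$). A maximum over an empty index set is taken to be $0$. *)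

(* Defs.v *)
From HB Require Import structures.
From mathcomp Require Import all_boot all_order all_algebra.
From mathcomp Require Import reals.

Set Implicit Arguments.
Unset Strict Implicit.
Unset Printing Implicit Defensive.

Import Order.TTheory GRing.Theory Num.Theory.
Local Open Scope ring_scope.

(* The analysis library's normed modules are over a numFieldType, normed by its
   own absolute value, so valuations and norms over a non-Archimedean field are
   introduced here as real-valued functions. *)
Record nonarch_valuation (R : realType) (K : fieldType) (v : K -> R) : Prop :=
  NonarchValuation {
    val_ge0 : forall a, 0 <= v a;
    val_eq0 : forall a, v a = 0 <-> a = 0;
    val_mul : forall a b, v (a * b) = v a * v b;
    val_ultra : forall a b, v (a + b) <= Num.max (v a) (v b)
  }.

Record nonarch_norm (R : realType) (K : fieldType) (v : K -> R)
    (X : lmodType K) (norm : X -> R) : Prop := NonarchNorm {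
  norm_ge0 : forall x, 0 <= norm x;
  norm_eq0 : forall x, norm x = 0 <-> x = 0;
  norm_scale : forall a x, norm (a *: x) = v a * norm x;
  norm_ultra : forall x y, norm (x + y) <= Num.max (norm x) (norm y)
}.

Definition norm_cauchy (R : realType) (X : zmodType) (norm : X -> R)
    (u : nat -> X) : Prop :=
  forall e : R, 0 < e -> exists m0 : nat,
    forall m n : nat, (m0 <= m)%N -> (m0 <= n)%N -> norm (u m - u n) < e.

Definition norm_cvg (R : realType) (X : zmodType) (norm : X -> R)
    (u : nat -> X) (l : X) : Prop :=
  forall e : R, 0 < e -> exists m0 : nat,
    forall m : nat, (m0 <= m)%N -> norm (u m - l) < e.

Definition norm_complete (R : realType) (X : zmodType) (norm : X -> R) : Prop :=
  forall u : nat -> X, norm_cauchy norm u -> exists l : X, norm_cvg norm u l.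

Record padic_inner_product (R : realType) (K : fieldType) (v : K -> R)
    (X : lmodType K) (norm : X -> R) (ip : X -> X -> K) : Prop :=
  PadicInnerProduct {
    ip_nondegenerate : forall x, (forall y, ip x y = 0) -> x = 0;
    ip_sym : forall x y, ip x y = ip y x;
    ip_linear : forall a x y z, ip (a *: x + y) z = a * ip x z + ip y z;
    ip_bounded : forall x y, v (ip x y) <= norm x * norm y
  }.

Record padic_hilbert (R : realType) (K : fieldType) (v : K -> R)
    (X : lmodType K) (norm : X -> R) (ip : X -> X -> K) : Prop :=
  PadicHilbert {
    hilbert_norm : nonarch_norm v norm;
    hilbert_complete : norm_complete norm;
    hilbert_ip : padic_inner_product v norm ip
  }.

Record orthonormal_basis (R : realType) (K : fieldType) (X : vectType K)
    (norm : X -> R) (ip : X -> X -> K) (n : nat) (tau : n.-tuple X) : Prop :=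
  OrthonormalBasis {
    onb_basis : basis_of {:X} tau;
    onb_norm : forall j : 'I_n, norm (tnth tau j) <= 1;
    onb_ip : forall j k : 'I_n, ip (tnth tau j) (tnth tau k) = (j == k)%:R
  }.

Definition supported_on (K : fieldType) (X : vectType K) (ip : X -> X -> K)
    (n : nat) (tau : n.-tuple X) (M : {set 'I_n}) (x : X) : Prop :=
  forall j : 'I_n, j \in ~: M -> ip x (tnth tau j) = 0.

(* Starting the maxima at 0 gives the empty maximum the value 0 and is otherwise
   harmless, as valuations are nonnegative. *)
Definition max_coeff (R : realType) (K : fieldType) (v : K -> R)
    (X : vectType K) (ip : X -> X -> K) (n : nat) (tau : n.-tuple X)
    (S : {set 'I_n}) (x : X) : R :=
  \big[Num.max/0]_(j in S) v (ip x (tnth tau j)).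

Definition max_cross (R : realType) (K : fieldType) (v : K -> R)
    (X : vectType K) (ip : X -> X -> K) (n : nat) (tau omega : n.-tuple X)
    (M N : {set 'I_n}) : R :=
  \big[Num.max/0]_(j in M) \big[Num.max/0]_(k in N)
    v (ip (tnth tau j) (tnth omega k)).

(* Main.v *)
Require Import Defs.
From HB Require Import structures.
From mathcomp Require Import all_boot all_order all_algebra.
From mathcomp Require Import reals.

Set Implicit Arguments.
Unset Strict Implicit.
Unset Printing Implicit Defensive.

Import Order.TTheory GRing.Theory Num.Theory.
Local Open Scope ring_scope.

(** The conclusion holds even without the factor [1 / (1 - c)], where [c < 1]
    is the largest cross coefficient.  Since the basis vectors have norm at
    most 1, the ultrametric inequality applied to the expansion of [x] in an
    orthonormal basis bounds [norm x] by the largest coefficient of [x]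
    ([norm_le_coeff]), while the Cauchy-Schwarz axiom bounds every coefficient
    by [norm x].

    Let [B] bound the coefficients of [x] off [M] in the basis [tau] and off
    [N] in the basis [omega].  For [k] in [N], expand
    [<x, omega_k> = \sum_j <x, tau_j> <tau_j, omega_k>]: the terms with [j] in
    [M] have valuation at most [c * norm x], and the others at most [B] because
    every cross coefficient has valuation at most 1.  Hence all
    the coefficients of [x] in [omega], and so [norm x] itself, are at most
    [max (c * norm x) B].  As [c < 1], the first argument of this maximum
    cannot dominate a nonzero [norm x], whence [norm x <= B]
    ([norm_le_off_support]).  Finally [1 <= 1 / (1 - c)], and a vector
    supported on both sets has [B = 0]. *)

(** * Ultrametric sums and orthonormal expansions *)

(** Stated for a bare function so that it serves both the valuation of the
    field and the norm of the space. *)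
Lemma ultra_sum (R : realType) (V : zmodType) (f : V -> R)
    (f_ultra : forall a b, f (a + b) <= Num.max (f a) (f b))
    (I : finType) (F : I -> V) (B : R) :
  f 0 <= B -> (forall i, f (F i) <= B) -> f (\sum_i F i) <= B.
Proof.
move=> f0 fF; apply: (big_ind (fun a => f a <= B)) => // a b fa fb.
by apply: le_trans (f_ultra a b) _; rewrite ge_max fa.
Qed.

Section PadicHilbert.

Context {R : realType} {K : fieldType} {v : K -> R}.
Context {X : vectType K} {norm : X -> R} {ip : X -> X -> K}.
Hypothesis hv : nonarch_valuation v.
Hypothesis hX : padic_hilbert v norm ip.

Let hnorm := hilbert_norm hX.
Let hip := hilbert_ip hX.

Lemma ip0l z : ip 0 z = 0.
Proof.
by have := ip_linear hip (-1) 0 0 z; rewrite scaler0 addr0 mulN1r addNr.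
Qed.

Lemma ip_suml (I : finType) (a : I -> K) (F : I -> X) z :
  ip (\sum_i a i *: F i) z = \sum_i a i * ip (F i) z.
Proof.
apply: (big_rec2 (fun x s => ip x z = s)) => [|i x s _ <-]; first exact: ip0l.
exact: (ip_linear hip).
Qed.

Context {n : nat} {tau : n.-tuple X}.
Hypothesis htau : orthonormal_basis norm ip tau.

Lemma onb_expansion x : x = \sum_j ip x (tnth tau j) *: tnth tau j.
Proof.
have Ex : x = \sum_j coord tau j x *: tnth tau j.
  rewrite {1}(coord_basis (onb_basis htau) (memvf x)).
  by apply: eq_bigr => j _; rewrite (tnth_nth 0).
rewrite {1}Ex; apply: eq_bigr => j _; congr (_ *: _).
rewrite {2}Ex ip_suml (bigD1 j) //= (onb_ip htau) eqxx mulr1.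
rewrite big1 ?addr0 // => i /negPf ij.
by rewrite (onb_ip htau) ij mulr0.
Qed.

Lemma onb_coeff_le x j : v (ip x (tnth tau j)) <= norm x.
Proof.
apply: le_trans (ip_bounded hip _ _) _.
by rewrite ler_piMr ?(norm_ge0 hnorm) ?(onb_norm htau).
Qed.

(** With [onb_coeff_le], this says that the norm is the maximum of the
    coefficients in an orthonormal basis, a non-Archimedean Parseval formula.
    The bound [0 <= B] covers the zero-dimensional space. *)
Lemma norm_le_coeff x (B : R) :
  0 <= B -> (forall j, v (ip x (tnth tau j)) <= B) -> norm x <= B.
Proof.
move=> B0 xB; rewrite (onb_expansion x).
apply: (ultra_sum (norm_ultra hnorm)) => [|j].
  by rewrite (norm_eq0 hnorm 0).2.
rewrite (norm_scale hnorm); apply: le_trans (xB j).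
by rewrite ler_piMr ?(val_ge0 hv) ?(onb_norm htau).
Qed.

End PadicHilbert.

(** * The uncertainty principle *)

Lemma le_max_cross (R : realType) (K : fieldType) (v : K -> R)
    (X : vectType K) (ip : X -> X -> K) (n : nat) (tau omega : n.-tuple X)
    (M N : {set 'I_n}) j k :
  j \in M -> k \in N ->
  v (ip (tnth tau j) (tnth omega k)) <= max_cross v ip tau omega M N.
Proof.
move=> jM kN; apply: le_trans
  (le_bigmax_cond _ (fun j => \big[Num.max/0]_(k in N) _) jM).
exact: (le_bigmax_cond _ (fun k => v (ip (tnth tau j) (tnth omega k))) kN).
Qed.

Lemma max_cross_ge0 (R : realType) (K : fieldType) (v : K -> R)
    (X : vectType K) (ip : X -> X -> K) (n : nat) (tau omega : n.-tuple X)
    (M N : {set 'I_n}) : 0 <= max_cross v ip tau omega M N.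
Proof. exact: bigmax_ge_id. Qed.

Lemma le_max_coeff (R : realType) (K : fieldType) (v : K -> R)
    (X : vectType K) (ip : X -> X -> K) (n : nat) (tau : n.-tuple X)
    (S : {set 'I_n}) x j :
  j \in S -> v (ip x (tnth tau j)) <= max_coeff v ip tau S x.
Proof.
exact: (le_bigmax_cond _ (fun j => v (ip x (tnth tau j)))).
Qed.

Lemma max_coeff_ge0 (R : realType) (K : fieldType) (v : K -> R)
    (X : vectType K) (ip : X -> X -> K) (n : nat) (tau : n.-tuple X)
    (S : {set 'I_n}) x : 0 <= max_coeff v ip tau S x.
Proof. exact: bigmax_ge_id. Qed.

Lemma max_coeff_supported (R : realType) (K : fieldType) (v : K -> R)
    (hv : nonarch_valuation v) (X : vectType K) (ip : X -> X -> K) (n : nat)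
    (tau : n.-tuple X) (M : {set 'I_n}) x :
  supported_on ip tau M x -> max_coeff v ip tau (~: M) x = 0.
Proof.
move=> xM; apply: big1_idem => [|j jM]; first exact: maxxx.
by rewrite xM //; apply/(val_eq0 hv).
Qed.

(** The sharp form: the ultrametric inequality absorbs the term
    [c * norm x] by comparison, where an Archimedean argument would subtract
    it and lose the factor [1 / (1 - c)]. *)
Lemma norm_le_off_support (R : realType) (K : fieldType) (v : K -> R)
    (hv : nonarch_valuation v)
    (X : vectType K) (norm : X -> R) (ip : X -> X -> K)
    (hX : padic_hilbert v norm ip)
    (n : nat) (tau omega : n.-tuple X)
    (htau : orthonormal_basis norm ip tau)
    (homega : orthonormal_basis norm ip omega)
    (M N : {set 'I_n})
    (hMN : max_cross v ip tau omega M N < 1) (x : X) :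
  norm x <= Num.max (max_coeff v ip tau (~: M) x)
                    (max_coeff v ip omega (~: N) x).
Proof.
set c := max_cross _ _ _ _ _ _ in hMN; set B := Num.max _ _.
have B0 : 0 <= B by rewrite le_max max_coeff_ge0.
have tauB j : j \notin M -> v (ip x (tnth tau j)) <= B.
  by move=> jM; rewrite le_max le_max_coeff // inE.
have omegaB k : k \notin N -> v (ip x (tnth omega k)) <= B.
  by move=> kN; rewrite le_max orbC le_max_coeff // inE.
have x_le : norm x <= Num.max (c * norm x) B.
  have D0 : 0 <= Num.max (c * norm x) B by rewrite le_max B0 orbT.
  apply: (norm_le_coeff hv hX homega D0) => k.
  have [kN|kN] := boolP (k \in N); last by rewrite le_max omegaB ?orbT.
  rewrite [in ip _ _](onb_expansion hX htau x) (ip_suml hX).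
  apply: (ultra_sum (val_ultra hv)) => [|j].
    by rewrite (val_eq0 hv 0).2.
  rewrite (val_mul hv) le_max; have [jM|jM] := boolP (j \in M).
    rewrite mulrC ler_pM ?(val_ge0 hv) ?le_max_cross //.
    exact: (onb_coeff_le hX htau).
  apply/orP; right; apply: le_trans (tauB j jM).
  rewrite ler_piMr ?(val_ge0 hv) //.
  by apply: le_trans (onb_coeff_le hX homega _ _) (onb_norm htau j).
have [//|B_lt] := leP (norm x) B.
(* Here [norm x > B >= 0], so both arguments of the maximum are < [norm x]. *)
move: x_le; rewrite leNgt gt_max B_lt andbT.
by rewrite gtr_pMl ?hMN // (le_lt_trans B0 B_lt).
Qed.

Theorem theorem2p5 (R : realType) (K : fieldType) (v : K -> R)
    (hv : nonarch_valuation v)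
    (X : vectType K) (norm : X -> R) (ip : X -> X -> K)
    (hX : padic_hilbert v norm ip)
    (n : nat) (tau omega : n.-tuple X)
    (htau : orthonormal_basis norm ip tau)
    (homega : orthonormal_basis norm ip omega)
    (M N : {set 'I_n})
    (hMN : max_cross v ip tau omega M N < 1) :
  (forall x : X,
     norm x <= (1 / (1 - max_cross v ip tau omega M N)) *
               Num.max (max_coeff v ip tau (~: M) x)
                       (max_coeff v ip omega (~: N) x)) /\
  (forall x : X,
     supported_on ip tau M x -> supported_on ip omega N x -> x = 0).
Proof.
split=> x => [|xM xN].
  apply: le_trans (norm_le_off_support hv hX htau homega hMN x) _.
  rewrite ler_peMl ?le_max ?max_coeff_ge0 // div1r invf_ge1 ?subr_gt0 //.
  by rewrite gerBl max_cross_ge0.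
apply/(norm_eq0 (hilbert_norm hX)); apply: le_anti.
rewrite (norm_ge0 (hilbert_norm hX)) andbT.
have := norm_le_off_support hv hX htau homega hMN x.
by rewrite !max_coeff_supported // maxxx.
Qed.
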